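(* Let $(\mathcal{M},\tau)$ be a tracial $W^*$-probability space, let $\{X_i\}_{i\ge 1}$ be freely independent self-adjoint operators affiliated with $\mathcal{M}$, all having the same spectral distribution function $U$. Let $\Psi_0(x)=(1-e^{-x})\mathbb{1}_{[0,\infty)}(x)$, and let $a_n>0$, $b_n\in\mathbb{R}$ be such that the spectral distribution functions $F_{W_n}$ of $$W_n=\frac{X_1\lor\cdots\lor X_n-b_n}{a_n}$$ converge weakly to $\Psi_0$ as $n\to\infty$. Assume that for each $n\ge 2$ the random variable $W_n$ has a density $u_n$ with respect to Lebesgue measure on $\mathbb{R}$ such that: (i) $\mathrm{supp}(u_n)=[A_n,B_n]$ for some $-\infty<A_n<B_n\le\infty$ (with $[A_n,B_n]=[A_n,\infty)$ if $B_n=\infty$); (ii) the limits $u_n(A_n+)=\lim_{t\to A_n+0}u_n(t)\in[0,\infty)$ and $u_n(B_n-)=\lim_{t\to B_n-0}u_n(t)=0$ exist; (iii) $u_n$ is differentiable on $(A_n,B_n)$; (iv) $\rho_n:=(\log u_n)'$ is bounded and continuous on $(A_n,B_n)$. Then for each $n\ge 2$, $$d_K(F_{W_n},\Psi_0)\le \tau\big(|1+\rho_n(W_n)|\big)+\big(1-e^{-|A_n|}\big)\,u_n(A_n+).$$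
   Context: A tracial $W^*$-probability space $(\mathcal{M},\tau)$ is a von Neumann algebra $\mathcal{M}$ (acting on a Hilbert space $\mathcal H$) with a tracial normal faithful state $\tau$. A (possibly unbounded) self-adjoint operator $X$ is affiliated with $\mathcal{M}$ if $f(X)\in\mathcal{M}$ for every bounded Borel function $f$ on $\mathbb{R}$; such operators are called random variables. The spectral distribution function of $X$ is $F_X(x)=\tau(\mathbb{1}_{(-\infty,x]}(X))$, $x\in\mathbb{R}$, where $\mathbb{1}_B$ is the indicator function of $B$. For projections $P,Q\in\mathcal{M}$, $P\lor Q$ is the projection onto the closure of $P\mathcal{H}+Q\mathcal{H}$. For self-adjoint $X,Y$ affiliated with $\mathcal{M}$, the spectral maximum $X\lor Y$ is the self-adjoint operator affiliated with $\mathcal{M}$ determined by $\mathbb{1}_{(x,\infty)}(X\lor Y)=\mathbb{1}_{(x,\infty)}(X)\lor\mathbb{1}_{(x,\infty)}(Y)$ for all $x\in\mathbb{R}$. For freely independent $X,Y$ one has $F_{X\lor Y}=\max\{F_X+F_Y-1,0\}$ (Ben Arous–Voiculescu); hence $F_{W_n}(x)=\max\{nU(a_nx+b_n)-(n-1),0\}$. ''$W_n$ has density $u_n$'' means $\tau(f(W_n))=\int_{\mathbb{R}}f(x)u_n(x)\,dx$ for all bounded Borel functions $f$; $\mathrm{supp}(u_n)=\overline{\{x:u_n(x)>0\}}$. Since $\rho_n$ is defined on $(A_n,B_n)$, where the distribution of $W_n$ is concentrated, $\tau(|1+\rho_n(W_n)|)=\int_{A_n}^{B_n}|1+\rho_n(x)|u_n(x)\,dx$.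 The Kolmogorov distance between distribution functions $F_1,F_2$ on $\mathbb{R}$ is $d_K(F_1,F_2)=\sup_{x\in\mathbb{R}}|F_1(x)-F_2(x)|$. *)

(* Defs.v *)
From HB Require Import structures.
From mathcomp Require Import all_boot all_order all_algebra.
From mathcomp Require Import complex.
From mathcomp Require Import all_classical all_reals all_analysis.
Set Implicit Arguments.
Unset Strict Implicit.
Unset Printing Implicit Defensive.
Import Order.TTheory GRing.Theory Num.Theory numFieldNormedType.Exports.
Local Open Scope classical_set_scope.
Local Open Scope ring_scope.
Local Open Scope complex_scope.

Structure hilbertSpace (R : realType) := HilbertSpace {
  hcarrier :> completeNormedModType R[i];
  dotp : {dot hcarrier for @Num.conj R[i]};
  norm_dotp : forall v : hcarrier, `|v| ^+ 2 = dotp v v }.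

Local Notation "''[' u , v ]" := (dotp _ u v) : ring_scope.

Section Operators.
Context {R : realType} {H : hilbertSpace R}.
Implicit Types (S T P Q : H -> H) (f : R -> R).

Definition bounded_op T : Prop := linear T /\ continuous T.

Definition is_adjoint T S : Prop :=
  forall v w : H, '[T v, w] = '[v, S w].

Definition bounded_sa T : Prop := bounded_op T /\ is_adjoint T T.

Definition op_le S T : Prop := forall v : H, 0 <= '[T v - S v, v].

Definition is_projection P : Prop := bounded_sa P /\ P \o P = P.

Definition proj_join P Q : H -> H :=
  xget (fun=> 0) [set S | is_projection S /\
    range S = closure [set v + w | v in range P & w in range Q]].

Definition commutant (N : set (H -> H)) : set (H -> H) :=
  [set S | bounded_op S /\ forall T, N T -> S \o T = T \o S].

(* The bicommutant condition makes [N] a unital, weakly closed algebra of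
   bounded operators. *)
Definition von_neumann_algebra (N : set (H -> H)) : Prop :=
  (forall T, N T -> exists2 S, N S & is_adjoint T S) /\
  commutant (commutant N) = N.

(* Only the values of [act] on [dom] are meaningful. *)
Record unbounded_op := UnboundedOp { dom : set H; act : H -> H }.

HB.instance Definition _ := gen_eqMixin unbounded_op.
HB.instance Definition _ := gen_choiceMixin unbounded_op.

(* The last clause says that the graphs of [X] and of its adjoint coincide. *)
Definition selfadjoint (X : unbounded_op) : Prop :=
  [/\ dom X 0,
      forall (c : R[i]) v w, dom X v -> dom X w ->
        dom X (c *: v + w) /\ act X (c *: v + w) = c *: act X v + act X w,
      dense (dom X) &
      forall v z : H, (dom X v /\ act X v = z) <->
        (forall w, dom X w -> '[act X w, v] = '[w, z])].

(* Projection-valued measures on the Borel sets of R; [pvm_meas E v] is the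
   scalar measure B |-> <E(B)v, v>. *)
Record pvm := Pvm {
  pvm_proj : set (measurableTypeR R) -> (H -> H);
  pvm_meas : H -> {measure set (measurableTypeR R) -> \bar R};
  pvm_projP : forall B, measurable B -> is_projection (pvm_proj B);
  pvm_projT : pvm_proj setT = id;
  pvm_projI : forall B C, measurable B -> measurable C ->
    pvm_proj (B `&` C) = pvm_proj B \o pvm_proj C;
  pvm_measE : forall v B, measurable B ->
    pvm_meas v B = (complex.Re '[pvm_proj B v, v])%:E }.

(* X = \int x dE(x); by polarization the quadratic form determines [act X]
   on [dom X]. *)
Definition spectral_measure (X : unbounded_op) (E : pvm) : Prop :=
  dom X = [set v : H | (\int[pvm_meas E v]_x (x ^+ 2)%:E < +oo)%E] /\
  forall v, dom X v -> '[act X v, v] = (\int[pvm_meas E v]_x x)%R%:C.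

Definition bounded_borel f : Prop :=
  measurable_fun [set: measurableTypeR R] (f : measurableTypeR R -> measurableTypeR R) /\
  exists C : R, forall x, `|f x| <= C.

(* [T] = f(X) = \int f dE, again characterized by its quadratic form. *)
Definition is_borel_calc (X : unbounded_op) f T : Prop :=
  exists E : pvm, [/\ spectral_measure X E, bounded_op T &
    forall v : H, '[T v, v] = (\int[pvm_meas E v]_x f x)%R%:C].

Definition borel_calc (X : unbounded_op) f : H -> H :=
  xget (fun=> 0) [set T | is_borel_calc X f T].

(* (X - b) / a *)
Definition rescale (X : unbounded_op) (a b : R) : unbounded_op :=
  UnboundedOp (dom X) (fun v => (a^-1)%:C *: (act X v - b%:C *: v)).

Definition normal_on (N : set (H -> H)) (tau : (H -> H) -> R[i]) : Prop :=
  forall (D : set (H -> H)) T,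
    D `<=` N -> D !=set0 -> (forall S, D S -> bounded_sa S) ->
    (forall S1 S2, D S1 -> D S2 ->
      exists S3, [/\ D S3, op_le S1 S3 & op_le S2 S3]) ->
    N T -> bounded_sa T -> (forall S, D S -> op_le S T) ->
    (forall T', bounded_sa T' -> (forall S, D S -> op_le S T') -> op_le T T') ->
    supremums (tau @` D) (tau T).

Record wstar_prob := WstarProb {
  alg : set (H -> H);
  tr : (H -> H) -> R[i];
  alg_vn : von_neumann_algebra alg;
  tr_linear : forall (c : R[i]) S T, alg S -> alg T ->
    tr (c \*: S \+ T) = c * tr S + tr T;
  tr_pos : forall S T, alg T -> is_adjoint T S -> 0 <= tr (S \o T);
  tr_id : tr id = 1;
  tr_tracial : forall S T, alg S -> alg T -> tr (S \o T) = tr (T \o S);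
  tr_faithful : forall S T, alg T -> is_adjoint T S ->
    tr (S \o T) = 0 -> T = (fun=> 0);
  tr_normal : normal_on alg tr }.

(* Real-valued [f] suffice: complex ones are combinations of two of them. *)
Definition affiliated (M : wstar_prob) (X : unbounded_op) : Prop :=
  selfadjoint X /\
  forall f, bounded_borel f -> exists2 T, is_borel_calc X f T & alg M T.

(* tau(f(X)), which is real because f(X) is self-adjoint *)
Definition expect (M : wstar_prob) (X : unbounded_op) f : R :=
  complex.Re (tr M (borel_calc X f)).

Definition spectral_df (M : wstar_prob) (X : unbounded_op) (x : R) : R :=
  expect M X \1_`]-oo, x].

Definition spectral_max (M : wstar_prob) (X Y : unbounded_op) : unbounded_op :=
  xget X [set Z | affiliated M Z /\ forall x : R,
    borel_calc Z \1_`]x, +oo[ =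
    proj_join (borel_calc X \1_`]x, +oo[) (borel_calc Y \1_`]x, +oo[)].

(* X 0 \/ ... \/ X (n - 1) for n >= 1 *)
Definition spectral_maxn (M : wstar_prob) (X : nat -> unbounded_op) (n : nat) :=
  foldl (spectral_max M) (X 0%N) [seq X i | i <- iota 1 n.-1].

Definition freely_independent (M : wstar_prob) (X : nat -> unbounded_op) : Prop :=
  forall (k : nat) (i : 'I_k.+1 -> nat) (f : 'I_k.+1 -> R -> R),
    (forall j l : 'I_k.+1, l = j.+1 :> nat -> i j <> i l) ->
    (forall j, bounded_borel (f j) /\ tr M (borel_calc (X (i j)) (f j)) = 0) ->
    tr M (\big[(fun S T => S \o T)/id]_(j < k.+1) borel_calc (X (i j)) (f j)) = 0.

Definition has_density (M : wstar_prob) (X : unbounded_op) (u : R -> R) : Prop :=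
  [/\ measurable_fun [set: measurableTypeR R]
        (u : measurableTypeR R -> measurableTypeR R),
      forall x, 0 <= u x &
      forall f, bounded_borel f ->
        (expect M X f)%:E = (\int[lebesgue_measure]_x (f x * u x)%:E)%E].

End Operators.
Arguments unbounded_op {R} H.
Arguments pvm {R} H.
Arguments wstar_prob {R} H.

Section RealLine.
Context {R : realType}.

(* closure of the set where the nonnegative function [u] is nonzero *)
Definition supp (u : R -> R) : set R := closure [set x | 0 < u x].

(* the filter t -> b - 0, with t -> +oo when b = +oo (b = -oo never occurs) *)
Definition at_left_ereal (b : \bar R) : set_system R :=
  match b with
  | r%:E => r^'-
  | +oo%E => pinfty_nbhs R
  | -oo%E => ninfty_nbhs R
  end.

Definition weak_cvg_df (F : nat -> R -> R) (G : R -> R) : Prop :=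
  forall x, {for x, continuous G} -> F n x @[n --> \oo] --> G x.

(* valued in the extended reals, where every set has a supremum *)
Definition kolmogorov_dist (F G : R -> R) : \bar R :=
  ereal_sup [set `|F x - G x|%:E | x in [set: R]].

Definition Psi0 (x : R) : R := (1 - expR (- x)) * \1_`[0, +oo[ x.

Definition log_deriv (u : R -> R) : R -> R := derive1 (fun x => ln (u x)).

End RealLine.

(* Main.v *)
Require Import Defs.
From mathcomp Require Import all_boot all_order all_algebra.
From mathcomp Require Import complex.
From mathcomp Require Import all_classical all_reals all_analysis.
From mathcomp Require Import measurable_realfun ring lra.
Import Order.TTheory GRing.Theory Num.Theory numFieldNormedType.Exports.
Set Implicit Arguments.
Unset Strict Implicit.
Unset Printing Implicit Defensive.
Local Open Scope classical_set_scope.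
Local Open Scope ring_scope.

(** Fix [n] and write [u], [A], [B], [rho] for the density of [W n], the
endpoints of its support and its logarithmic derivative, [L] for [u(A+)] and
[F] for the distribution function. The estimate rests on the fact that [Psi0]
solves [Psi0' + Psi0 = 1] on the positive half-line and vanishes on the
negative one, that is, it inverts [d/dx + 1] up to an integration. Applied to
[u], the operator [d/dx + 1] gives [k = u' + u = (1 + rho) u] on [(A, B)]
and, because [u] jumps from [0] to [L] at [A], a point mass [L] at [A]. Hence
  [F(x) = L Psi0(x - A) + \int_A^B k(s) Psi0(x - s) ds]   ([df_convolution]).
Since [u(B-) = 0], integrating [u'] and [u] separately over [(A, B)] gives
  [1 = L + \int_A^B k(s) ds]                             ([density_mass_split]).
Subtracting [Psi0(x)] times the second identity from the first one yields
  [F(x) - Psi0(x) = L (Psi0(x - A) - Psi0(x))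
                    + \int_A^B k(s) (Psi0(x - s) - Psi0(x)) ds].
The increment of [Psi0] over a step [a] is at most [1 - exp(-|a|)]
([Psi0_shift]), which bounds the first term, and two values of [Psi0] differ
by at most [1], which bounds the second one by
[\int_A^B |1 + rho| u = tau(|1 + rho(W n)|)].

Both integral identities are instances of one computation
([density_transport]): the product [v(s) = u(s) (1 - c exp(s))] satisfies
[v' = k (1 - c exp(s)) - u], and the fundamental theorem of calculus applies
to it on [(A, y)]. As [v] is only controlled through its limits at the two
ends, and the right end may be infinite, this uses the improper form
[Rintegral_derive_eitv], obtained by exhausting the interval by compact ones.

On the operator side, expectations are integrals against [u], so what is left
is that [u] has total mass [1] ([density_mass]), i.e. that the calculus of
[W n] sends the constant [1] to the identity. Functions of [W n] with no value
in the calculus are sent to the operator [0] by convention, which has trace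
[0]; as [u] is positive on an interval, the expectation of the constant [1]
is nonzero, so [W n] does have a spectral resolution, and an operator with the
quadratic form of the identity is the identity ([quadratic_form_eq_id]). *)

(** * The constant function in the functional calculus *)

Section TotalMass.
Context {R : realType} {H : hilbertSpace R}.
Local Notation "''[' u , v ]" := (dotp H u v) : ring_scope.

Lemma dotp_eq0 (v : H) : '[v, v] = 0 -> v = 0.
Proof.
by move=> v0; apply/eqP; rewrite -normr_eq0 -sqrf_eq0 norm_dotp v0.
Qed.

Lemma dotpDl (u v w : H) : '[u + v, w] = '[u, w] + '[v, w].
Proof. exact: linearDl. Qed.

Lemma dotpDr (u v w : H) : '[u, v + w] = '[u, v] + '[u, w].
Proof. exact: linearDr. Qed.

Lemma dotpZl (c : R[i]) (u v : H) : '[c *: u, v] = c * '[u, v].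
Proof. exact: linearZl_LR. Qed.

Lemma dotpZr (c : R[i]) (u v : H) : '[u, c *: v] = Num.conj c * '[u, v].
Proof. exact: linearZr_LR. Qed.

(** Complex polarization: for [S = T - id], the vanishing of the form at
[v + w] and at [v + 'i w] makes [<S v, w>] both skew and symmetric under the
exchange of [v] and [w]. *)
Lemma quadratic_form_eq_id (T : H -> H) : linear T ->
  (forall v, '[T v, v] = '[v, v]) -> T = id.
Proof.
move=> lT Tvv.
have TD v w : T (v + w) = T v + T w.
  by have := lT 1 v w; rewrite !scale1r.
have T0 : T 0 = 0 by apply: (addIr (T 0)); rewrite -TD !add0r.
have TZ a v : T (a *: v) = a *: T v by have := lT a v 0; rewrite T0 !addr0.
pose S v := T v - v.
have Svv v : '[S v, v] = 0.
  by rewrite /S dotpDl Tvv -scaleN1r dotpZl mulN1r subrr.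
have Sadj v w : '[S v, w] + '[S w, v] = 0.
  have := Svv (v + w).
  have -> : S (v + w) = S v + S w by rewrite /S TD opprD addrACA.
  by rewrite dotpDl !dotpDr !Svv add0r addr0.
have Svw v w : '[S v, w] = 0.
  have := Sadj v ('i%C *: w).
  have -> : S ('i%C *: w) = 'i%C *: S w by rewrite /S TZ scalerBr.
  rewrite dotpZr dotpZl.
  have -> : Num.conj ('i%C : R[i]) = - 'i%C by apply/eqP; rewrite eq_complex /= oppr0 !eqxx.
  have := Sadj v w => /eqP; rewrite addr_eq0 => /eqP ->.
  rewrite mulrNN -mulrDr => /eqP; rewrite mulf_eq0.
  have /negbTE -> : ('i%C : R[i]) != 0 by rewrite eq_complex /= oner_eq0 andbF.
  by rewrite -mulr2n mulrn_eq0 /= => /eqP ->; rewrite oppr0.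
by apply/funext => v; apply/subr0_eq/dotp_eq0/Svw.
Qed.

Lemma bounded_borel_cst1 : bounded_borel (cst 1 : R -> R).
Proof.
split; first exact: measurable_cst.
by exists 1 => x; rewrite /= normr1.
Qed.

Lemma is_borel_calc1 (X : unbounded_op H) T :
  is_borel_calc X (cst 1) T -> T = id.
Proof.
case=> E [_ [lT _] Tvv]; apply: quadratic_form_eq_id => // v.
rewrite Tvv (_ : (\int[pvm_meas E v]_x cst 1 x)%R = complex.Re '[v, v]); last first.
  rewrite /Rintegral.
  under eq_integral do rewrite /cst.
  by rewrite integral_cst// mul1e pvm_measE// pvm_projT.
have : '[v, v] \is Num.real.
  by rewrite -norm_dotp rpredX// normr_real.
by move=> /RRe_real ->.
Qed.

Lemma tr0 (M : wstar_prob H) : tr M (fun=> 0) = 0.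
Proof.
have idM : alg M id.
  rewrite -(alg_vn M).2; split=> //.
  by split => // x.
have := tr_linear (-1) idM idM.
rewrite tr_id mulr1 addNr => <-; congr (tr M _).
by apply/funext => x /=; rewrite scaleN1r addNr.
Qed.

(** Either [X] has no spectral resolution, and then every function of [X] is
the default operator [0], of trace [0], or the constant [1] is sent to [id]. *)
Lemma expect1_neq0 (M : wstar_prob H) (X : unbounded_op H) :
  expect M X (cst 1) != 0 -> expect M X (cst 1) = 1.
Proof.
rewrite /expect /borel_calc.
case: xgetP => [T _ XT _|_]; last by rewrite tr0 eqxx.
by rewrite (is_borel_calc1 XT) tr_id.
Qed.

End TotalMass.

(** * The fundamental theorem of calculus on an open interval *)

Section ImproperFTC.
Context {R : realType}.
Implicit Types (A s : R) (y : \bar R).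
Local Notation mu := (@lebesgue_measure R).

(** The open interval from [A] to [y], in the form in which the support of a
density is given: the right end is an extended real, so that bounded and
unbounded supports are treated together. *)
Definition eitv A y : set R := [set s | A < s /\ (s%:E < y)%E].

Lemma eitvE A y : (A%:E < y)%E ->
  exists b : itv_bound R, eitv A y = [set` Interval (BRight A) b].
Proof.
case: y => [r| |] // _.
- by exists (BLeft r); apply/seteqP; split=> s; rewrite /eitv/= in_itv/= lte_fin => /andP.
- exists +oo%O; apply/seteqP; split=> s; rewrite /eitv/= in_itv/= andbT; first by case.
  by move=> ?; split=> //; exact: ltry.
Qed.

Lemma measurable_eitv A y : (A%:E < y)%E -> measurable (eitv A y : set (measurableTypeR R)).
Proof. by move=> /eitvE[b ->]; exact: measurable_itv. Qed.

Lemma open_eitv A y : (A%:E < y)%E -> open (eitv A y).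
Proof.
case: y => [r| |] // _.
- rewrite (_ : eitv _ _ = `]A, r[%classic); first exact: interval_open.
  by apply/seteqP; split=> s; rewrite /eitv/= in_itv/= lte_fin => /andP.
- rewrite (_ : eitv _ _ = `]A, +oo[%classic); first exact: interval_open.
  apply/seteqP; split=> s; rewrite /eitv/= in_itv/= andbT; first by case.
  by move=> ?; split=> //; exact: ltry.
Qed.

Lemma eitv_sub_itv A y p q : A < p -> (q%:E < y)%E -> `[p, q]%classic `<=` eitv A y.
Proof.
move=> Ap qy s /=; rewrite in_itv/= => /andP[ps sq]; split.
  exact: lt_le_trans ps.
by apply: le_lt_trans qy; rewrite lee_fin.
Qed.

(** The convergence of the endpoints is along the one-sided filters, so that
one-sided limits of a function can be composed with the two sequences. *)
Lemma eitv_exhaust A y : (A%:E < y)%E -> exists p q : nat -> R,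
  [/\ forall n, [/\ A < p n, p n < q n & ((q n)%:E < y)%E],
      p n @[n --> \oo] --> A^'+ & q n @[n --> \oo] --> at_left_ereal y].
Proof.
have c (e : R) : (fun n => e / n.+3%:R) @ \oo --> 0.
  rewrite -(mulr0 e); apply: cvgM; first exact: cvg_cst.
  have := @cvg_harmonic R; rewrite -(cvg_shiftn 2).
  by apply: cvg_trans; apply: near_eq_cvg; near=> n; rewrite /harmonic/= addn2.
have right p : (forall n, A < p n) -> p n @[n --> \oo] --> A -> p n @[n --> \oo] --> A^'+.
  move=> Ap pA P; rewrite /at_right => /pA.
  by apply: (@filterS _ \oo _ (fun n => A < p n -> P (p n))) => n; apply; exact: Ap.
have left (r : R) q : (forall n, q n < r) -> q n @[n --> \oo] --> r -> q n @[n --> \oo] --> r^'-.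
  move=> Ap pA P; rewrite /at_left => /pA.
  by apply: (@filterS _ \oo _ (fun n => q n < r -> P (q n))) => n; apply; exact: Ap.
case: y => [r| |] // Ay.
- have Ar : 0 < r - A by rewrite subr_gt0 -lte_fin.
  have d0 n : 0 < (r - A) / n.+3%:R by rewrite divr_gt0.
  (* with denominators at least 3, the two endpoints cannot meet *)
  exists (fun n => A + (r - A) / n.+3%:R), (fun n => r - (r - A) / n.+3%:R); split.
  + move=> n; have := d0 n; set d := _ / _ => dn0.
    have : 2 * d < r - A.
      by rewrite /d mulrCA gtr_pMr// ltr_pdivrMr// mul1r ltr_nat.
    by move=> d2; split; rewrite ?lte_fin; lra.
  + apply: right => [n|]; first by rewrite ltrDl d0.
    by rewrite -[X in _ --> X]addr0; apply: cvgD; [exact: cvg_cst|exact: c].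
  + apply: left => [n|]; first by rewrite ltrBlDr ltrDl d0.
    by rewrite -[X in _ --> X]subr0; apply: cvgB; [exact: cvg_cst|exact: c].
- exists (fun n => A + 1 / n.+3%:R), (fun n => A + 1 + n%:R); split.
  + move=> n; rewrite ltrDl divr_gt0// ltry; split=> //.
    have : (1 / n.+3%:R : R) < 1 by rewrite ltr_pdivrMr// mul1r ltr1n.
    by rewrite -addrA ltrD2l => /lt_le_trans; apply; rewrite lerDl.
  + apply: right => [n|]; first by rewrite ltrDl divr_gt0.
    by rewrite -[X in _ --> X]addr0; apply: cvgD; [exact: cvg_cst|exact: c].
  + apply/cvgryPge => M; near=> n; rewrite -lerBlDl.
    by near: n; exact: nbhs_infty_ger.
Unshelve. all: by end_near. Qed.

(** Dominated convergence: each point of the interval eventually belongs to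
the exhausting segments, and [`|f|] dominates the truncations of [f]. *)
Lemma cvg_Rintegral_exhaust A y (f : R -> R) p q : (A%:E < y)%E ->
  mu.-integrable (eitv A y) (EFin \o f) ->
  (forall n, [/\ A < p n, p n < q n & ((q n)%:E < y)%E]) ->
  p n @[n --> \oo] --> A^'+ -> q n @[n --> \oo] --> at_left_ereal y ->
  (\int[mu]_(s in `[p n, q n]) f s)%R @[n --> \oo] --> (\int[mu]_(s in eitv A y) f s)%R.
Proof.
move=> Ay fi pqP pA qy.
have mD := measurable_eitv Ay.
have mf := measurable_int mu fi.
have fin : (\int[mu]_(s in eitv A y) (f s)%:E)%E \is a fin_num by exact: integrable_fin_num.
apply: fine_cvg; rewrite fineK//.
rewrite (_ : (fun n => _) =
   (fun n => \int[mu]_(s in eitv A y) ((EFin \o f) \_ `[p n, q n]) s)%E); last first.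
  apply/funext => n; rewrite -integral_mkcondr setIidr//.
  by have [Ap _ qn] := pqP n; exact: eitv_sub_itv.
apply: (@dominated_cvg _ _ _ mu _ mD _ _ (fun s => `|f s|%:E)%E).
- move=> n; apply: (measurable_restrict (EFin \o f) (measurable_itv `[p n, q n]) mD).1.
  by apply: measurable_funS mf => //; apply: subIsetl.
- move=> s [As sy]; apply: cvg_near_cst.
  have pn : \forall n \near \oo, p n <= s.
    have : \forall x \near A^'+, x <= s.
      by near=> x; apply: ltW; near: x; exact: nbhs_right_lt.
    exact: pA.
  have qn : \forall n \near \oo, s <= q n.
    have : \forall x \near at_left_ereal y, s <= x.
      case: y sy {Ay fi mD mf fin pqP qy} => [r| |] //= sr.
      + by near=> x; apply: ltW; near: x; apply: nbhs_left_gt; rewrite -lte_fin.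
      + by apply: nbhs_pinfty_ge; rewrite num_real.
    exact: qy.
  by near=> n; rewrite patchE mem_set//= in_itv/=; apply/andP; split; near: n.
- by case/integrableP: fi.
- by move: fi => /integrable_abse.
- move=> n s _; rewrite patchE; case: ifPn => _ //=.
  by rewrite normr0 lee_fin.
Unshelve. all: by end_near. Qed.

(** Only limits of the primitive [v] are available at the ends, so the theorem
for segments is applied on [[p n, q n]] and passed to the limit by dominated
convergence. *)
Lemma Rintegral_derive_eitv A y (v v' : R -> R) l r : (A%:E < y)%E ->
  (forall s, eitv A y s -> is_derive s 1 v (v' s)) ->
  (forall s, eitv A y s -> {for s, continuous v'}) ->
  mu.-integrable (eitv A y) (EFin \o v') ->
  v s @[s --> A^'+] --> l -> v s @[s --> at_left_ereal y] --> r ->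
  (\int[mu]_(s in eitv A y) v' s)%R = r - l.
Proof.
move=> Ay dv cv' iv' vl vr.
have [p [q [pqP pA qy]]] := eitv_exhaust Ay.
have h := cvg_Rintegral_exhaust Ay iv' pqP pA qy.
apply: (cvg_unique _ h) => //.
rewrite (_ : (fun n => _) = (fun n => v (q n) - v (p n))).
  by apply: cvgB; [exact: cvg_comp qy vr|exact: cvg_comp pA vl].
apply/funext => n; have [Ap pq qn] := pqP n.
have sub := eitv_sub_itv Ap qn.
have Dv s : p n <= s <= q n -> is_derive s 1 v (v' s).
  by move=> psq; apply/dv/sub; rewrite /= in_itv.
have cv s : p n <= s <= q n -> {for s, continuous v}.
  by move=> /Dv [+ _]; move=> /derivable1_diffP/differentiable_continuous.
rewrite /Rintegral (@continuous_FTC2 _ v' v)//.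
- apply: continuous_in_subspaceT => s /[!inE] /sub; exact: cv'.
- split.
  + move=> s; rewrite in_itv/= => /andP[ps sq].
    by have [] := Dv s; rewrite ?(ltW ps) ?ltW.
  + by apply/cvg_at_right_filter/cv; rewrite lexx ltW.
  + by apply/cvg_at_left_filter/cv; rewrite lexx ltW.
- move=> s; rewrite in_itv/= => /andP[ps sq].
  by rewrite derive1E; have [] := Dv s; rewrite ?(ltW ps) ?ltW.
Qed.

End ImproperFTC.

(** * Increments of the exponential distribution function *)

Section ExponentialDistribution.
Context {R : realType}.
Implicit Types s t x a : R.

Lemma Psi0_ge0E x : 0 <= x -> Psi0 x = 1 - expR (- x).
Proof. by move=> x0; rewrite /Psi0 indicE mem_set ?mulr1//= in_itv/= x0. Qed.

Lemma Psi0_le0E x : x <= 0 -> Psi0 x = 0.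
Proof.
rewrite le_eqVlt => /predU1P[->|x0]; first by rewrite Psi0_ge0E// oppr0 expR0 subrr.
by rewrite /Psi0 indicE memNset ?mulr0//= in_itv/= leNgt x0.
Qed.

Lemma Psi0_itv x : 0 <= Psi0 x <= 1.
Proof.
have [x0|/ltW x0] := leP 0 x; last by rewrite Psi0_le0E// lexx ler01.
rewrite Psi0_ge0E// lerBlDr lerDl expR_ge0 andbT subr_ge0.
by rewrite -[leRHS]expR0 ler_expR lerNl oppr0.
Qed.

(** The density [exp(-x)] decreases on the half-line that carries it, so among
the steps of a given length the one starting at [0] gains most. *)
Lemma Psi0_increment s t : s <= t -> 0 <= Psi0 t - Psi0 s <= 1 - expR (- (t - s)).
Proof.
move=> st; have e1 : expR (- (t - s)) <= 1.
  by rewrite -[leRHS]expR0 ler_expR lerNl oppr0 subr_ge0.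
have [t0|/ltW t0] := leP t 0.
  by rewrite !Psi0_le0E ?(le_trans st t0)// subrr lexx subr_ge0.
have [s0|/ltW s0] := leP s 0.
  rewrite (Psi0_le0E s0) subr0; have /andP[-> _] /= := Psi0_itv t.
  by rewrite Psi0_ge0E// lerD2l lerN2 ler_expR lerN2 lerBrDl gerDr.
rewrite !Psi0_ge0E//.
have -> : 1 - expR (- t) - (1 - expR (- s)) = expR (- s) * (1 - expR (- (t - s))).
  by rewrite mulrBr mulr1 -expRD [- (t - s)]opprB addKr; ring.
rewrite mulr_ge0 ?expR_ge0 ?subr_ge0//= ler_piMl ?subr_ge0//.
by rewrite -[leRHS]expR0 ler_expR lerNl oppr0.
Qed.

Lemma Psi0_shift a x : `|Psi0 (x - a) - Psi0 x| <= 1 - expR (- `|a|).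
Proof.
have [a0|/ltW a0] := leP 0 a.
  have := @Psi0_increment (x - a) x; rewrite gerBl a0 => /(_ isT) /andP[h0 h1].
  by rewrite distrC !ger0_norm//; move: h1; rewrite subKr.
have := @Psi0_increment x (x - a); rewrite lerBrDr gerDl a0 => /(_ isT) /andP[h0 h1].
by rewrite ger0_norm// ler0_norm//; move: h1; have -> : x - a - x = - a by ring.
Qed.

Lemma measurable_Psi0 : measurable_fun [set: R] (@Psi0 R).
Proof.
apply: measurable_funM; last exact: measurable_indic.
apply: measurable_funB; first exact: measurable_cst.
by apply: measurableT_comp => //; exact: measurable_expR.
Qed.

End ExponentialDistribution.

(** * Densities with a bounded logarithmic derivative *)

Section Density.
Context {R : realType}.
Local Notation mu := (@lebesgue_measure R).

(** [rho] is the logarithmic derivative of [u], but only [u' = rho u] is asked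
for: this is linear in [u] and mentions no logarithm. *)
Record regular_density (A : R) (B : \bar R) (u rho : R -> R) (L : R) : Prop := {
  rd_lt : (A%:E < B)%E;
  rd_ge0 : forall s, 0 <= u s;
  rd_out : forall s, ~ (A <= s /\ (s%:E <= B)%E) -> u s = 0;
  rd_meas : measurable_fun [set: R] u;
  rd_mass : (\int[mu]_s (u s)%:E = 1)%E;
  rd_right : u s @[s --> A^'+] --> L;
  rd_left : u s @[s --> at_left_ereal B] --> 0;
  rd_derive : forall s, eitv A B s -> is_derive s 1 u (rho s * u s);
  rd_cont : forall s, eitv A B s -> {for s, continuous rho};
  rd_bnd : exists C, forall s, eitv A B s -> `|rho s| <= C }.

Variables (A : R) (B : \bar R) (u rho : R -> R) (L : R).
Hypothesis H : regular_density A B u rho L.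
Let D := eitv A B.
(* k = u' + u *)
Let k s := (1 + rho s) * u s.

Let mD : measurable (D : set (measurableTypeR R)).
Proof. exact: measurable_eitv (rd_lt H). Qed.

Lemma integrable_density E : measurable (E : set (measurableTypeR R)) ->
  mu.-integrable E (EFin \o u).
Proof.
move=> mE; apply: (@integrableS _ _ _ _ setT) => //.
apply/integrableP; split; first by apply/measurable_EFinP; exact: (rd_meas H).
under eq_integral do rewrite /= ger0_norm ?(rd_ge0 H)//.
by rewrite (rd_mass H) ltry.
Qed.

Lemma measurable_rho : measurable_fun D rho.
Proof.
apply: open_continuous_measurable_fun; first exact: open_eitv (rd_lt H).
by move=> s /[!inE]; exact: (rd_cont H).
Qed.

Lemma measurable_norm_defect : measurable_fun D (fun s => `|1 + rho s|).
Proof.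
apply: measurableT_comp => //.
by apply: measurable_funD; [exact: measurable_cst|exact: measurable_rho].
Qed.

Lemma integrable_defect : mu.-integrable D (EFin \o k).
Proof.
have [C hC] := rd_bnd H.
apply: (@le_integrable _ _ _ mu D mD _ (fun s => (1 + C)%:E * (EFin \o u) s)%E).
- apply/measurable_EFinP; apply: measurable_funM.
    by apply: measurable_funD; [exact: measurable_cst|exact: measurable_rho].
  by apply: measurable_funS (rd_meas H).
- move=> s Ds /=; rewrite lee_fin !normrM ler_wpM2r//.
  rewrite (le_trans (ler_normD _ _))// normr1 (le_trans _ (ler_norm _))//.
  by rewrite lerD2l; exact: hC.
- by apply: integrableZl => //; exact: integrable_density.
Qed.

Lemma integrable_defect_mul (phi : R -> R) : measurable_fun [set: R] phi ->
  (forall s, D s -> `|phi s| <= 1) -> mu.-integrable D (fun s => (k s * phi s)%:E).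
Proof.
move=> mphi phi1; apply: le_integrable integrable_defect => //.
  apply/measurable_EFinP; apply: measurable_funM; last exact: measurable_funTS.
  by apply/measurable_EFinP; exact: measurable_int integrable_defect.
by move=> s Ds /=; rewrite lee_fin normrM ler_piMr//; exact: phi1.
Qed.

(** The support is [[A, B]] while the hypotheses on [u] hold on [(A, B)]; the
endpoints form a null set. *)
Lemma density_off_support E : measurable (E : set (measurableTypeR R)) ->
  (\int[mu]_(s in E) u s = \int[mu]_(s in E `&` D) u s)%R.
Proof.
move=> mE; rewrite Rintegral_mkcondr; congr fine.
apply: ae_eq_integral => //.
- by apply/measurable_EFinP; apply: measurable_funTS; exact: (rd_meas H).
- apply/measurable_EFinP; apply: measurable_funTS.
  by apply/(measurable_restrictT _ _).1 => //; apply: measurable_funTS; exact: (rd_meas H).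
(* when B is infinite, fine B is 0: one more point does no harm *)
exists [set A; fine B]; split.
- by apply: measurableU; exact: measurable_set1.
- apply: countable_lebesgue_measure0; apply: finite_set_countable.
  by rewrite finite_setU; split; exact: finite_set1.
- move=> s /= /not_implyP[Es]; rewrite patchE; case: ifPn => // nD us.
  have /not_andP nD' : ~ D s by move=> Ds; move: nD; rewrite mem_set.
  apply: contrapT => /not_orP[/eqP sA sB]; apply: us; rewrite (rd_out H)// => -[As sleB].
  case: nD'; first by rewrite lt_neqAle eq_sym sA As.
  apply: contra_notP => _; rewrite lt_neqAle sleB andbT.
  by apply/eqP => sB'; apply: sB; rewrite -sB'.
Qed.

(** The functions [phi = 1 - c exp] are the solutions of [phi - phi' = 1], so
that [(u phi)' = k phi - u]. The bound on [c exp] keeps [phi] in [[0, 1]], so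
that [k phi] is integrable even on an unbounded interval. *)
Lemma density_transport (y : \bar R) (c : R) : (A%:E < y)%E -> (y <= B)%E ->
  0 <= c -> (forall s, eitv A y s -> c * expR s <= 1) ->
  u s * (1 - c * expR s) @[s --> at_left_ereal y] --> 0 ->
  (\int[mu]_(s in eitv A y) u s =
   (1 - c * expR A) * L + \int[mu]_(s in eitv A y) (k s * (1 - c * expR s)))%R.
Proof.
move=> Ay yB c0 c1 vy.
have my := measurable_eitv Ay.
have sub : eitv A y `<=` D by move=> s [As sy]; split=> //; exact: lt_le_trans yB.
have mphi : measurable_fun [set: R] (fun s => 1 - c * expR s).
  apply: measurable_funB; first exact: measurable_cst.
  by apply: measurable_funM; [exact: measurable_cst|exact: measurable_expR].
have iu := integrable_density my.
have ik : mu.-integrable (eitv A y) (fun s => (k s * (1 - c * expR s))%:E).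
  apply: (@le_integrable _ _ _ mu _ my _ (EFin \o k)).
  - apply/measurable_EFinP; apply: measurable_funM; last exact: measurable_funTS.
    apply/measurable_EFinP; apply: (measurable_int mu).
    exact: integrableS integrable_defect.
  - move=> s ys /=; rewrite lee_fin normrM ler_piMr// ger0_norm.
      by rewrite lerBlDr lerDl mulr_ge0// expR_ge0.
    by rewrite subr_ge0; exact: c1.
  - exact: integrableS integrable_defect.
pose v' s := k s * (1 - c * expR s) - u s.
have dv : (\int[mu]_(s in eitv A y) v' s = 0 - L * (1 - c * expR A))%R.
  apply: (@Rintegral_derive_eitv _ _ _ (fun s => u s * (1 - c * expR s))) => //.
  - move=> s /sub Ds; have du := rd_derive H Ds.
    have dphi : is_derive s 1 (fun t => 1 - c * expR t) (- (c * expR s)).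
      have := is_deriveB (is_derive_cst (1 : R) s 1) (is_deriveZ c (is_derive_expR s)).
      by rewrite sub0r.
    apply: is_derive_eq (is_deriveM du dphi) _.
    by rewrite /v' /k /GRing.scale/=; ring.
  - move=> s /sub Ds.
    have cu : {for s, continuous u}.
      have [du _] := rd_derive H Ds.
      by move: du => /derivable1_diffP/differentiable_continuous.
    apply: cvgB => //; apply: cvgM.
      by apply: cvgM => //; apply: cvgD; [exact: cvg_cst|exact: (rd_cont H)].
    apply: cvgB; first exact: cvg_cst.
    by apply: cvgM; [exact: cvg_cst|exact: continuous_expR].
  - exact: (integrableB my ik iu).
  - apply: cvgM; first exact: (rd_right H).
    apply: cvg_at_right_filter; apply: cvgB; first exact: cvg_cst.
    by apply: cvgM; [exact: cvg_cst|exact: continuous_expR].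
move: dv; rewrite RintegralB// => /eqP; rewrite subr_eq => /eqP ->; ring.
Qed.

(** The case [phi = 1], on the whole support: the boundary value of [u phi] at
the right end is the limit of [u], which is [0]. *)
Lemma density_mass_split : 1 = L + (\int[mu]_(s in D) k s)%R.
Proof.
have mass : (\int[mu]_(s in D) u s)%R = 1.
  by rewrite -[D]setTI -density_off_support// /Rintegral (rd_mass H).
have := @density_transport B 0 (rd_lt H) (lexx _) (lexx _).
rewrite mass mul0r subr0 mul1r => ->; first congr (L + _).
- by apply: eq_Rintegral => s _; rewrite mul0r subr0 mulr1.
- by move=> s _; rewrite mul0r ler01.
- under eq_fun do rewrite mul0r subr0 mulr1.
  exact: (rd_left H).
Qed.

(** For [s <= x] one has [Psi0 (x - s) = 1 - exp(-x) exp(s)], which is the test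
function of [density_transport] for [c = exp(-x)]; it vanishes at [s = x], so
cutting the support at [x] creates no boundary term, and if [x] lies beyond
the support then the boundary term vanishes because [u] does. *)
Lemma df_convolution x : (\int[mu]_(s in `]-oo, x]) u s =
  Psi0 (x - A) * L + \int[mu]_(s in D) (k s * Psi0 (x - s)))%R.
Proof.
rewrite -Rintegral_itv_bndo_bndc; last exact: integrable_density.
rewrite density_off_support//.
have [xA|Ax] := leP x A.
  rewrite Psi0_le0E ?subr_le0// mul0r add0r.
  rewrite (_ : _ `&` D = set0) ?Rintegral_set0; last first.
    apply/seteqP; split=> s // [/=]; rewrite in_itv/= => sx [As _].
    by have := lt_trans As (lt_le_trans sx xA); rewrite ltxx.
  rewrite (@eq_Rintegral _ _ _ _ _ (cst 0)) ?Rintegral_cst ?mul0r//.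
  move=> s /[!inE] -[As _]; rewrite Psi0_le0E ?mulr0// subr_le0.
  by rewrite (le_trans xA)// ltW.
pose y := mine x%:E B.
have -> : `]-oo, x[ `&` D = eitv A y.
  apply/seteqP; split=> s; rewrite /D /eitv /y /= in_itv/= lt_min lte_fin.
    by move=> [sx [As sB]]; rewrite sx sB.
  by move=> [As /andP[sx sB]]; rewrite sx sB.
have Ay : (A%:E < y)%E by rewrite lt_min lte_fin Ax (rd_lt H).
have yB : (y <= B)%E by rewrite ge_min lexx orbT.
have ex s : 1 - expR (- x) * expR s = 1 - expR (- (x - s)).
  by rewrite -expRD opprB [- x + s]addrC.
rewrite (@density_transport y (expR (- x)))//.
- rewrite ex Psi0_ge0E ?subr_ge0 ?ltW//; congr (_ + _).
  rewrite [RHS](_ : _ = \int[mu]_(s in D `&` eitv A y) (k s * Psi0 (x - s)))%R; last first.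
    rewrite [RHS]Rintegral_mkcondr; apply: eq_Rintegral => s; rewrite inE => -[As sB].
    rewrite patchE; case: ifPn => //; rewrite notin_setE => sy.
    rewrite Psi0_le0E ?mulr0// subr_le0 leNgt; apply/negP => sx; apply: sy.
    by split=> //; rewrite lt_min lte_fin sx.
  rewrite setIidr; last by move=> s [As sy]; split=> //; exact: lt_le_trans yB.
  apply: eq_Rintegral => s /[!inE] -[As]; rewrite lt_min lte_fin => /andP[sx _].
  by rewrite ex Psi0_ge0E// subr_ge0 ltW.
- move=> s [As]; rewrite lt_min lte_fin => /andP[sx _].
  rewrite -subr_ge0 ex -Psi0_ge0E; first by have /andP[] := Psi0_itv (x - s).
  by rewrite subr_ge0 ltW.
- have [xB|Bx] := ltP x%:E B.
    rewrite /y min_l ?ltW//=.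
    have Dx : D x by split.
    have cu : {for x, continuous u}.
      have [du _] := rd_derive H Dx.
      by move: du => /derivable1_diffP/differentiable_continuous.
    apply: cvg_at_left_filter.
    rewrite [X in _ --> X](_ : _ = u x * (1 - expR (- x) * expR x)).
      apply: cvgM => //; apply: cvgB; first exact: cvg_cst.
      by apply: cvgM; [exact: cvg_cst|exact: continuous_expR].
    by rewrite ex subrr oppr0 expR0 subrr mulr0.
  rewrite /y min_r//; move: Bx (rd_lt H) (rd_left H).
  case: B => [b| |] //= _ _ ub.
  rewrite -(mul0r (1 - expR (- x) * expR b)); apply: cvgM => //.
  apply: cvg_at_left_filter; apply: cvgB; first exact: cvg_cst.
  by apply: cvgM; [exact: cvg_cst|exact: continuous_expR].
Qed.

Lemma df_Psi0_dist x : `|(\int[mu]_(s in `]-oo, x]) u s)%R - Psi0 x| <=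
  (\int[mu]_(s in D) `|k s|)%R + (1 - expR (- `|A|)) * L.
Proof.
have L0 : 0 <= L.
  rewrite -(cvg_lim _ (rd_right H))//; apply: limr_ge.
    by apply/cvg_ex; exists L; exact: (rd_right H).
  by apply: nearW => s; exact: (rd_ge0 H).
have mshift : measurable_fun [set: R] (fun s => Psi0 (x - s)).
  apply: (measurableT_comp measurable_Psi0).
  by apply: measurable_funB => //; exact: measurable_cst.
have i1 : mu.-integrable D (fun s => (k s * Psi0 (x - s))%:E).
  apply: integrable_defect_mul => // s _.
  by have /andP[h0 h1] := Psi0_itv (x - s); rewrite ger0_norm.
have i2 : mu.-integrable D (fun s => (k s * Psi0 x)%:E).
  apply: integrable_defect_mul => // s _.
  by have /andP[h0 h1] := Psi0_itv x; rewrite ger0_norm.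
have i3 : mu.-integrable D (fun s => (k s * (Psi0 (x - s) - Psi0 x))%:E).
  under eq_fun do rewrite mulrBr.
  exact: (integrableB mD i1 i2).
(* df_convolution minus Psi0 x times density_mass_split *)
have -> : (\int[mu]_(s in `]-oo, x]) u s)%R - Psi0 x =
    (\int[mu]_(s in D) (k s * (Psi0 (x - s) - Psi0 x)))%R + (Psi0 (x - A) - Psi0 x) * L.
  under [in RHS]eq_Rintegral do rewrite mulrBr.
  rewrite RintegralB// (RintegralZr _ mD integrable_defect)// df_convolution.
  rewrite -{1}[Psi0 x]mul1r {1}density_mass_split; ring.
apply: (le_trans (ler_normD _ _)); apply: lerD.
  apply: (le_trans (le_normr_Rintegral _ _)) => //.
  apply: le_Rintegral => //.
  - exact: integrable_norm i3.
  - exact: integrable_norm integrable_defect.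
  move=> s _; rewrite normrM ler_piMr//.
  have /andP[a0 a1] := Psi0_itv (x - s); have /andP[b0 b1] := Psi0_itv x.
  by rewrite ler_norml; apply/andP; split; lra.
by rewrite normrM (ger0_norm L0) ler_wpM2r// Psi0_shift.
Qed.

End Density.

(** * Random variables with a density *)

Section Expectations.
Context {R : realType} {H : hilbertSpace R}.
Variables (M : wstar_prob H) (X : unbounded_op H) (u : R -> R).
Local Notation mu := (@lebesgue_measure R).
Hypothesis dX : has_density M X u.

(** Positivity of [u] on some interval is what excludes that all functions of
[X] are the default operator [0], which is compatible with [u = 0]. *)
Lemma density_mass a b : a < b -> (forall s, a < s < b -> 0 < u s) ->
  (\int[mu]_s (u s)%:E = 1)%E.
Proof.
move=> ab upos; have [mu' u0 eX] := dX.
have e1 : (expect M X (cst 1))%:E = (\int[mu]_s (u s)%:E)%E.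
  rewrite eX; last exact: bounded_borel_cst1.
  by apply: eq_integral => s _; rewrite /= mul1r.
rewrite -e1 expect1_neq0//; apply/eqP => E0.
have mEu : measurable_fun [set: measurableTypeR R] (EFin \o u) by exact/measurable_EFinP.
have : (\int[mu]_s `|(EFin \o u) s|)%E = 0%E.
  under eq_integral do rewrite /= ger0_norm//.
  by rewrite -e1 E0.
move=> /(ae_eq_integral_abs mu measurableT mEu)[N [mN N0 uN]].
have : (mu `]a, b[ <= mu N)%E.
  apply: le_measure; rewrite ?inE//.
  move=> s; rewrite /= in_itv/= => sab; apply: uN => /= /(_ I)[us].
  by have := upos _ sab; rewrite us ltxx.
by rewrite N0 lebesgue_measure_itv/= lte_fin ab -EFinB lee_fin leNgt subr_gt0 ab.
Qed.

Lemma expect_density f : bounded_borel f ->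
  expect M X f = (\int[mu]_s (f s * u s))%R.
Proof. by move=> bf; have [_ _ /(_ f bf) e] := dX; rewrite /Rintegral -e. Qed.

Lemma spectral_df_density x : spectral_df M X x = (\int[mu]_(s in `]-oo, x]) u s)%R.
Proof.
rewrite /spectral_df expect_density.
  rewrite [RHS]Rintegral_mkcond; apply: eq_Rintegral => s _.
  by rewrite patchE indicE; case: ifP => _; rewrite ?mul1r ?mul0r.
split; first exact: measurable_indic.
by exists 1 => s; rewrite indicE; case: (_ \in _); rewrite ?normr1 ?normr0 ?ler01.
Qed.

End Expectations.

Lemma is_derive_log_deriv {R : realType} (u : R -> R) s : 0 < u s -> derivable u s 1 ->
  is_derive s 1 u (log_deriv u s * u s).
Proof.
move=> us du.
have Du : is_derive s 1 u (derive1 u s) by rewrite derive1E; exact: derivableP.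
have -> : log_deriv u s = (u s)^-1 * derive1 u s.
  rewrite /log_deriv derive1E.
  by have [_ ->] := is_derive1_comp (is_derive1_ln us) Du.
by rewrite mulrAC mulVf ?mul1r ?gt_eqF.
Qed.

(** * The Kolmogorov distance to the exponential distribution *)

Theorem theorem3p2 (R : realType) (H : hilbertSpace R) (M : wstar_prob H)
    (X : nat -> unbounded_op H) (U : R -> R) (a b : nat -> R)
    (W : nat -> unbounded_op H)
    (u : nat -> R -> R) (A : nat -> R) (B : nat -> \bar R) :
  (forall i, affiliated M (X i)) ->
  freely_independent M X ->
  (forall i x, spectral_df M (X i) x = U x) ->
  (forall n, (0 < n)%N -> 0 < a n) ->
  (forall n, (0 < n)%N -> W n = rescale (spectral_maxn M X n) (a n) (b n)) ->
  weak_cvg_df (fun n => spectral_df M (W n)) Psi0 ->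
  (forall n, (2 <= n)%N -> has_density M (W n) (u n)) ->
  (forall n, (2 <= n)%N -> ((A n)%:E < B n)%E /\
     supp (u n) = [set x | A n <= x /\ (x%:E <= B n)%E]) ->
  (forall n, (2 <= n)%N -> cvg (u n t @[t --> (A n)^'+]) /\
     u n t @[t --> at_left_ereal (B n)] --> (0 : R)) ->
  (forall n x, (2 <= n)%N -> A n < x -> (x%:E < B n)%E ->
     derivable (u n) x 1) ->
  (forall n x, (2 <= n)%N -> A n < x -> (x%:E < B n)%E -> 0 < u n x) ->
  (forall n, (2 <= n)%N ->
     (exists C : R, forall x, A n < x -> (x%:E < B n)%E ->
        `|log_deriv (u n) x| <= C) /\
     (forall x, A n < x -> (x%:E < B n)%E ->
        {for x, continuous (log_deriv (u n))})) ->
  forall n, (2 <= n)%N ->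
    (kolmogorov_dist (spectral_df M (W n)) Psi0 <=
       (expect M (W n)
          (fun x => `|1 + log_deriv (u n) x|%R
             * \1_[set y | A n < y /\ (y%:E < B n)%E] x)%R
        + (1 - expR (- `|A n|)) * lim (u n t @[t --> (A n)^'+]))%:E)%E.
Proof.
move=> _ _ _ _ _ _ dW supW limW derW posW rhoW n n2.
have {}dW := dW n n2; have {supW} [AB suppu] := supW n n2.
have {limW} [limA limB] := limW n n2; have {rhoW} [rhoC rho_cont] := rhoW n n2.
have {}derW x := derW n x n2; have {}posW x := posW n x n2.
have [mu' u0 _] := dW.
have rd : regular_density (A n) (B n) (u n) (log_deriv (u n)) (lim (u n t @[t --> (A n)^'+])).
  split=> //.
  (* off its closed support, u is not positive, hence zero *)
  - move=> s; rewrite -[_ /\ _]/([set x | A n <= x /\ (x%:E <= B n)%E] s) -suppu => Ns.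
    apply/eqP; rewrite eq_le u0 andbT leNgt; apply/negP => us.
    by apply: Ns; apply: subset_closure.
  - have [p [q [pq _ _]]] := eitv_exhaust AB.
    have [Ap pq0 qB] := pq 0%N.
    apply: (density_mass dW pq0) => s /andP[ps sq]; apply: posW.
      exact: lt_trans ps.
    by apply: lt_trans qB; rewrite lte_fin.
  - by move=> s [As sB]; apply: is_derive_log_deriv; [exact: posW|exact: derW].
  - by move=> s [As sB]; exact: rho_cont.
  - by have [C hC] := rhoC; exists C => s [As sB]; exact: hC.
apply: ge_ereal_sup => _ [x _ <-]; rewrite lee_fin (spectral_df_density dW).
apply: (le_trans (df_Psi0_dist rd x)); rewrite lerD2r le_eqVlt; apply/orP; left; apply/eqP.
rewrite (expect_density dW).
  rewrite Rintegral_mkcond; apply: eq_Rintegral => s _.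
  rewrite patchE indicE -/(eitv (A n) (B n)).
  by case: ifP => _; rewrite ?mulr1 ?mulr0 ?mul0r// normrM (ger0_norm (u0 s)).
have mD := measurable_eitv AB.
split.
  rewrite (_ : (fun x => _) = (fun x => `|1 + log_deriv (u n) x|) \_ (eitv (A n) (B n))).
    exact: (iffLR (measurable_restrictT _ mD) (measurable_norm_defect rd)).
  apply/funext => s; rewrite patchE indicE -/(eitv (A n) (B n)).
  by case: ifP => _; rewrite ?mulr1 ?mulr0.
have [C hC] := rhoC; exists (1 + `|C|) => s.
rewrite normrM normr_id indicE.
case: (boolP (s \in _)) => [/[!inE] -[As sB]|_]; last by rewrite normr0 mulr0 addr_ge0.
rewrite normr1 mulr1 (le_trans (ler_normD _ _))// normr1 lerD2l.
by rewrite (le_trans (hC _ As sB))// ler_norm.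
Qed.
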